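(* Let $\vec{G}=(\mathcal{V},\vec{\mathcal{E}})$ be a directed acyclic graph with $n$ vertices such that the longest directed path in $\vec{G}$ has length $\ell\geq 1$. If $\vec{G}$ is strongly reduced, then $\vec{G}$ has at most $t(n-\ell+1,2)+T(n,\ell,1)$ edges.
   Context: A directed acyclic graph (DAG) is a simple directed graph without directed cycles. A topological order of a directed graph is an ordering $v_1,\dots,v_n$ of its vertices such that $i<j$ for every directed edge $(v_i,v_j)$. A directed path from $v$ to $w$ is a sequence of vertices $v=u_0,\dots,u_k=w$ such that $(u_{i-1},u_i)$ is a directed edge for every $1\le i\le k$; its length is $k$ (the number of edges). Given a topological order $\mathcal{O}$ and two directed paths $\gamma,\gamma'$ from $v$ to $w$, $\gamma\cup_{\mathcal{O}}\gamma'$ denotes the sequence consisting of all vertices belonging to $\gamma$ or $\gamma'$ (each listed once), in the order given by $\mathcal{O}$. A finite DAG is strongly reduced if for every topological order $\mathcal{O}$ of it, every pair of vertices $v,w$, and every pair of directed paths $\gamma,\gamma'$ from $v$ to $w$, the sequence $\gamma\cup_{\mathcal{O}}\gamma'$ is a directed path from $v$ to $w$. $t(m,2)$ denotes the number of edges of the $2$-partite Turán graph on $m$ vertices (the complete bipartite graph on $m$ vertices with part sizes differing by at most one), and $$T(n,\ell,1)=\binom{n}{2}-\binom{n-\ell+1}{2}=(n-\ell+1)(\ell-1)+\frac{(\ell-1)(\ell-2)}{2}.$$ *)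

(* Defs.v *)
From mathcomp Require Import all_boot.

Set Implicit Arguments.
Unset Strict Implicit.
Unset Printing Implicit Defensive.

(* A simple directed graph on the finite vertex type V is an irreflexive
   relation: multiple edges are excluded by the encoding. A directed cycle is
   a nonempty ucycle (distinct vertices). *)
Definition dag (V : finType) (e : rel V) : Prop :=
  irreflexive e /\ forall c : seq V, ucycle e c -> c = [::].

Definition num_edges (V : finType) (e : rel V) : nat :=
  #|[set p : V * V | e p.1 p.2]|.

Definition topological_order (V : finType) (e : rel V) (O : seq V) : Prop :=
  [/\ uniq O, forall v, v \in O
    & forall v w, e v w -> index v O < index w O].

(* s is the full vertex sequence u_0, ..., u_k, with u_0 = v and u_k = w; the
   case k = 0 is allowed. *)
Definition dipath (V : finType) (e : rel V) (v w : V) (s : seq V) : bool :=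
  if s is x :: p then [&& x == v, path e x p & last x p == w] else false.

Definition dipath_length (V : finType) (s : seq V) : nat := (size s).-1.

Definition dipath_union (V : finType) (O g g' : seq V) : seq V :=
  [seq x <- O | (x \in g) || (x \in g')].

Definition strongly_reduced (V : finType) (e : rel V) : Prop :=
  forall O : seq V, topological_order e O ->
  forall (v w : V) (g g' : seq V),
    dipath e v w g -> dipath e v w g' -> dipath e v w (dipath_union O g g').

Definition longest_dipath_length (V : finType) (e : rel V) (l : nat) : Prop :=
  (exists v w s, dipath e v w s /\ dipath_length s = l) /\
  (forall v w s, dipath e v w s -> dipath_length s <= l).

(* The r-partite Turan graph on m vertices: the parts are the residue classes
   modulo r of 0, ..., m-1, whose sizes differ by at most one. *)
Definition turan_graph (m r : nat) : rel 'I_m :=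
  fun i j => i %% r != j %% r.

(* Each undirected edge is counted once, with its smaller endpoint first. *)
Definition turan_number (m r : nat) : nat :=
  #|[set p : 'I_m * 'I_m | (p.1 < p.2) && turan_graph r p.1 p.2]|.

(* T(n, l, 1). No subtraction truncates when 1 <= l <= n, which holds for the
   longest path length l >= 1 of a DAG on n vertices (indeed l < n). *)
Definition T1 (n l : nat) : nat := 'C(n, 2) - 'C(n - l + 1, 2).

(* Main.v *)
Require Import Defs.
From mathcomp Require Import all_boot.
From mathcomp Require Import zify.

(** Order the vertices by reachability. When the graph is strongly reduced,
    the paths from [v] to [w] can be merged until one of them passes through
    every vertex between [v] and [w]; hence every closed interval of this order
    has at most [l + 1] elements ([card_interval]). Every edge is a comparable
    pair, so it suffices to bound the number of comparable pairs in a finite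
    order with this property.

    That bound is proved by deleting elements of small degree one by one, in the
    style of the degree proof of Mantel's theorem. Among [n] elements, take a
    minimal [x] and a maximal [y]. The elements comparable with [x] are those
    above it, the elements comparable with [y] are those below it, and the
    elements that are both form the interval from [x] to [y], which is empty
    when [x <= y] fails. So the sizes of the two sets, which contain [x] and [y]
    themselves, add up to at most [n + (l + 1)], and [x] or [y] is comparable
    with at most [(n - 1 + l) / 2] other elements ([delete_extremal]). Summing
    these degrees over the deletions gives [card_le_pairs]; the sum equals the
    bound of the theorem ([sum_deletions]): its first [l + 1] terms add up to
    ['C(l + 1, 2)], the bound for [n = l + 1], and each later term is the
    increment [l - 1] of [T1] plus that of [turan_number]. *)

Set Implicit Arguments.
Unset Strict Implicit.
Unset Printing Implicit Defensive.

(** * Comparable pairs in an order with small intervals *)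

Lemma minimal_exists (V : finType) (le : rel V) (A : {set V}) :
  reflexive le -> antisymmetric le -> transitive le -> A != set0 ->
  exists2 x, x \in A & [set z in A | le z x] = [set x].
Proof.
move=> le_refl le_anti le_trans /set0Pn[a aA].
case: (@arg_minnP _ a (fun x => x \in A)
  (fun x => #|[set z in A | le z x]|) aA) => x xA minx.
exists x => //; apply/setP=> z; rewrite !inE.
apply/andP/eqP => [[zA lezx]|->]; last by rewrite xA le_refl.
apply: le_anti; rewrite lezx; apply: contraT => /= nlexz.
have := minx z zA; rewrite leqNgt => /negP; case.
apply: proper_card; apply/properP; split.
  by apply/subsetP=> u; rewrite !inE => /andP[-> leuz]; apply: le_trans lezx.
by exists x; rewrite !inE ?xA ?le_refl.
Qed.

Section SmallIntervals.
Variables (V : finType) (le : rel V).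
Hypotheses (le_refl : reflexive le) (le_anti : antisymmetric le)
  (le_trans : transitive le).

Definition le_pairs (A : {set V}) : {set V * V} :=
  [set p in setX A A | (p.1 != p.2) && le p.1 p.2].
Definition above (A : {set V}) (x : V) := [set z in A | le x z].
Definition below (A : {set V}) (x : V) := [set z in A | le z x].

Lemma card_le_pairs_delete (A : {set V}) (x : V) :
  #|le_pairs A| <= #|le_pairs (A :\ x)| + #|above A x :\ x| + #|below A x :\ x|.
Proof.
have sub : le_pairs A \subset le_pairs (A :\ x)
    :|: [set (x, z) | z in above A x :\ x]
    :|: [set (z, x) | z in below A x :\ x].
  apply/subsetP => -[a b]; rewrite !inE /= => /andP[/andP[aA bA] /andP[ab leab]].
  case: (eqVneq a x) => [ax|ax].
    apply/orP; left; apply/orP; right; apply/imsetP; exists b; last by rewrite ax.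
    by rewrite !inE -ax eq_sym ab bA.
  case: (eqVneq b x) => [bx|bx]; last by rewrite aA bA ab leab.
  apply/orP; right; apply/imsetP; exists a; last by rewrite bx.
  by rewrite !inE -bx ab aA.
apply: (leq_trans (subset_leq_card sub)).
apply: (leq_trans (leq_card_setU _ _)); apply: leq_add; last exact: leq_imset_card.
by apply: (leq_trans (leq_card_setU _ _)); rewrite leq_add2l leq_imset_card.
Qed.

Variable l : nat.
Hypothesis interval_le : forall x y, #|[set z | le x z && le z y]| <= l.+1.

(** For [x] minimal and [y] maximal, the elements above [x] and those below [y]
    meet in the interval from [x] to [y], which bounds the sum of the two degrees by [#|A|.-1 + l]; the element
    of smaller degree is deleted. *)
Lemma delete_extremal (A : {set V}) : A != set0 ->
  exists2 x, x \in A & #|le_pairs A| <=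
    #|le_pairs (A :\ x)| + minn #|A|.-1 (#|A|.-1 + l)./2.
Proof.
move=> A0; have [x xA] := minimal_exists le_refl le_anti le_trans A0.
rewrite -/(below A x) => minx.
have [||y yA] := @minimal_exists _ (fun a b => le b a) A le_refl _ _ A0.
- by move=> a b /andP[leba leab]; apply: le_anti; rewrite leab.
- by move=> b a c leba lecb; apply: le_trans leba.
rewrite -/(above A y) => maxy.
have Apos : 0 < #|A| by rewrite card_gt0.
have degx : #|above A x| = #|above A x :\ x|.+1.
  by rewrite (cardsD1 x) !inE xA le_refl.
have degy : #|below A y| = #|below A y :\ y|.+1.
  by rewrite (cardsD1 y) !inE yA le_refl.
have sumU : #|above A x :|: below A y| <= #|A|.
  by apply: subset_leq_card; apply/subsetP=> z; rewrite !inE; case: (z \in A).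
have sumI : #|above A x :&: below A y| <= l.+1.
  apply: leq_trans (interval_le x y); apply: subset_leq_card.
  by apply/subsetP=> z; rewrite !inE => /andP[/andP[_ ->] /andP[_ ->]].
have sumUI := cardsUI (above A x) (below A y).
have leA : forall B : {set V}, B \subset A -> #|B| <= #|A|.
  by move=> B; apply: subset_leq_card.
have upA : #|above A x| <= #|A|.
  by apply: leA; apply/subsetP=> z; rewrite inE => /andP[].
have dnA : #|below A y| <= #|A|.
  by apply: leA; apply/subsetP=> z; rewrite inE => /andP[].
have delx := card_le_pairs_delete A x; have dely := card_le_pairs_delete A y.
rewrite minx setDv cards0 in delx; rewrite maxy setDv cards0 in dely.
case: (leqP #|above A x| #|below A y|) => cmp; [exists x | exists y] => //; lia.
Qed.

Lemma card_le_pairs (A : {set V}) :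
  #|le_pairs A| <= \sum_(j < #|A|) minn j (j + l)./2.
Proof.
move: {-1}(#|A|) (erefl #|A|) => k.
elim: k A => [|k IHk] A cardA.
  move/eqP: cardA; rewrite cards_eq0 => /eqP->.
  rewrite big_ord0 leqn0 cards_eq0.
  by apply/eqP/setP => p; rewrite !inE.
have A0 : A != set0 by rewrite -card_gt0 cardA.
have [x xA le_del] := delete_extremal A0.
rewrite big_ord_recr /=; apply: leq_trans le_del _.
rewrite cardA leq_add2r; apply: IHk.
by move: (cardsD1 x A); rewrite xA cardA add1n => -[].
Qed.

End SmallIntervals.

(** * The arithmetic of the bound *)

Lemma sum_opposite_parity (j : nat) :
  \sum_(i < j) (i %% 2 != j %% 2) = uphalf j.
Proof.
elim: j => [|j IHj]; first by rewrite big_ord0.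
(* A number has the parity of [j.+1] exactly when it does not have that of
   [j], so the sum for [j.+1] is [j.+1] minus the sum for [j]. *)
have -> : \sum_(i < j.+1) (i %% 2 != j.+1 %% 2)
        = \sum_(i < j.+1) (1 - (i %% 2 != j %% 2)).
  apply: eq_bigr => i _; rewrite !modn2 /=.
  by case: (odd i); case: (odd j).
have le1 (i : nat) : (i %% 2 != j %% 2 : nat) <= 1 by case: (_ != _).
rewrite sumnB => [|i _]; last exact: le1.
rewrite sum1_card card_ord big_ord_recr /= IHj eqxx; lia.
Qed.

(** The vertex [j] of the bipartite Turan graph has [uphalf j] neighbours
    among the vertices before it. *)
Lemma turan_number2 (m : nat) : turan_number m 2 = \sum_(j < m) uphalf j.
Proof.
rewrite /turan_number cardsE -sum1_card.
rewrite -(pair_big_dep xpredT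
  (fun i j : 'I_m => (i < j) && turan_graph 2 i j) (fun _ _ => 1)) /=.
rewrite (exchange_big_dep xpredT) //=; apply: eq_bigr => j _.
rewrite -sum_opposite_parity (big_ord_widen_cond m xpredT
  (fun i => (i %% 2 != j %% 2) : nat)) ?(ltnW (ltn_ord j)) //.
rewrite big_mkcondr /=; apply: eq_bigr => i _.
by rewrite /turan_graph; case: (_ != _).
Qed.

Lemma sum_deletions (n l : nat) : 0 < l < n ->
  \sum_(j < n) minn j (j + l)./2 <= turan_number (n - l + 1) 2 + T1 n l.
Proof.
case/andP=> l0 ln; rewrite -(subnKC ln).
elim: (n - l.+1) => [|k IHk].
  (* The right-hand side is ['C(l.+1, 2)]: the Turan graph on two vertices has one
     edge, and [T1] is short of this binomial by one. *)
  rewrite addn0 /T1 (_ : l.+1 - l + 1 = 2); last lia.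
  have -> : turan_number 2 2 = 1 by rewrite turan_number2 !big_ord_recr big_ord0.
  rewrite binn subnKC ?bin_gt0 //.
  rewrite -bin2_sum big_mkord; apply: leq_sum => j _; exact: geq_minl.
rewrite addnS big_ord_recr /=.
move: IHk; rewrite /T1 (_ : l.+1 + k - l + 1 = k.+2); last lia.
rewrite (_ : (l.+1 + k).+1 - l + 1 = k.+3); last lia.
rewrite !turan_number2 (big_ord_recr k.+2) /= => IHk.
have binS (a : nat) : 'C(a.+1, 2) = 'C(a, 2) + a by rewrite binS bin1.
have le_bin : 'C(k.+2, 2) <= 'C(l.+1 + k, 2) by apply: leq_bin2l; lia.
rewrite (binS (l.+1 + k)) (binS k.+2); lia.
Qed.

(** * Reachability in a strongly reduced graph *)

Section Reachability.
Variables (V : finType) (e : rel V).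
Hypothesis hdag : dag e.

Lemma edge_no_return (x z : V) : e x z -> ~~ connect e z x.
Proof.
move=> exz; apply/negP => /connectP[p /shortenP[q pq uq _] xlast].
have: ucycle e (z :: q) by rewrite /ucycle /= rcons_path pq -xlast exz.
by move/(proj2 hdag).
Qed.

Lemma connect_anti : antisymmetric (connect e).
Proof.
move=> x y /andP[/connectP[[|z p] /= pp ->] // cyx].
case/andP: pp => exz pz; have := edge_no_return exz.
by rewrite (connect_trans _ cyx) //; apply/connectP; exists p.
Qed.

(** Sorting by the number of ancestors works, as this number strictly
    increases along every edge. *)
Lemma topological_order_exists : exists O, topological_order e O.
Proof.
pose f (x : V) := #|[set z | connect e z x]|.
have lt_f x y : e x y -> f x < f y.
  move=> exy; apply: proper_card; apply/properP; split.
    by apply/subsetP=> z; rewrite !inE => /connect_trans; apply; apply: connect1.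
  by exists y; rewrite !inE ?connect0 // edge_no_return.
pose O := sort (relpre f leq) (enum V).
have inO v : v \in O by rewrite mem_sort mem_enum.
exists O; split=> [|//|v w evw]; first by rewrite sort_uniq enum_uniq.
rewrite ltnNge; apply/negP => le_idx.
have srt : sorted (relpre f leq) O.
  by apply: sort_sorted => x y; apply: leq_total.
have := @sorted_leq_nth _ (relpre f leq) (fun b a c => @leq_trans _ _ _)
  (fun x => leqnn (f x)) v O srt (index w O) (index v O).
rewrite !inE !index_mem => /(_ (inO w) (inO v) le_idx).
by rewrite /= !nth_index // leqNgt lt_f.
Qed.

Lemma dipath_uniq (v w : V) (s : seq V) : dipath e v w s -> uniq s.
Proof.
have [O [_ _ hO]] := topological_order_exists.
case: s => [//|x p] /and3P[_ px _].
apply: (@sorted_uniq _ (relpre (index^~ O) ltn)).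
- by move=> b a c; apply: ltn_trans.
- by move=> a; apply: ltnn.
- by apply: sub_path px => a b; apply: hO.
Qed.

Hypothesis hsr : strongly_reduced e.

(** Merging with a path through each vertex of [zs] in turn. *)
Lemma dipath_through (v w : V) (zs : seq V) : connect e v w ->
  {in zs, forall z, connect e v z && connect e z w} ->
  exists2 g, dipath e v w g & {subset zs <= g}.
Proof.
have [O hO] := topological_order_exists; have [_ inO _] := hO.
move=> cvw; elim: zs => [|z zs IHzs] between.
  have [p pp wp] := connectP cvw.
  by exists (v :: p); rewrite // /dipath pp -wp !eqxx.
have [|g pg sub_g] := IHzs; first by move=> u uzs; apply: between; rewrite inE uzs orbT.
have /andP[/connectP[p pp zp] /connectP[q pq wq]] := between z (mem_head _ _).
have pg' : dipath e v w (v :: p ++ q).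
  by rewrite /dipath cat_path last_cat -zp pp pq -wq !eqxx.
exists (dipath_union O g (v :: p ++ q)); first exact: hsr.
move=> u; rewrite inE mem_filter inO andbT => /predU1P[->|/sub_g->] //.
by rewrite -cat_cons mem_cat zp mem_last orbT.
Qed.

Lemma card_interval (l : nat) (v w : V) :
  (forall v w s, dipath e v w s -> dipath_length s <= l) ->
  #|[set z | connect e v z && connect e z w]| <= l.+1.
Proof.
move=> le_l; set I := [set z | _].
case: (boolP (connect e v w)) => [cvw|ncvw]; last first.
  rewrite (_ : I = set0) ?cards0 //; apply/setP=> z; rewrite !inE.
  by apply: contraNF ncvw => /andP[]; apply: connect_trans.
have [|g pg sub_g] := @dipath_through v w (enum I) cvw.
  by move=> z; rewrite mem_enum inE.
rewrite cardE; apply: (leq_trans (uniq_leq_size (enum_uniq _) sub_g)).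
by move: (le_l _ _ _ pg); rewrite /dipath_length; case: (g).
Qed.

End Reachability.

Theorem corollary3p19 (V : finType) (e : rel V) (n l : nat)
  (hdag : dag e) (hn : #|V| = n)
  (hl : longest_dipath_length e l) (hl1 : 1 <= l)
  (hsr : strongly_reduced e) :
  num_edges e <= turan_number (n - l + 1) 2 + T1 n l.
Proof.
have [[v [w [s [ps size_s]]]] le_l] := hl.
have ln : l < n.
  have := max_card (mem s); rewrite (card_uniqP (dipath_uniq hdag ps)) hn.
  by move: ps size_s; rewrite /dipath_length; case: (s) => //= x p _ ->.
apply: leq_trans (sum_deletions (introT andP (conj hl1 ln))).
have := @card_le_pairs V (connect e) (@connect0 _ e) (connect_anti hdag)
  (@connect_trans _ e) l (fun x y => card_interval hdag hsr x y le_l) setT.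
rewrite cardsT hn; apply: leq_trans; apply: subset_leq_card.
apply/subsetP=> -[x y]; rewrite !inE /= => exy.
rewrite (connect1 exy) andbT; apply: contraTneq exy => ->.
by rewrite (proj1 hdag).
Qed.
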